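(* Let $B\le\mathrm{poly}(n)$ be an a priori upper bound on the multiplicity of every edge in the final graph. There is an online scheme for \textsc{MaxMatching} on strict turnstile graph streams over $n$ vertices (with multiplicities bounded by $B$) with total cost (help cost plus space cost) $O(B\cdot n\log n)$ bits and error at most $1/3$.
   Context: Strict turnstile graph streams: a stream is $\langle (e_1,\Delta_1),\dots,(e_m,\Delta_m)\rangle$ with each $e_i$ an undirected pair of vertices from $[n]$ and $\Delta_i\in\mathbb Z$; update $i$ adds $\Delta_i$ to the multiplicity of $e_i$. Final multiplicities are assumed nonnegative (intermediate ones may be negative) and at most $B$; the final graph $G$ has an edge $\{u,v\}$ iff its final multiplicity is positive. \textsc{MaxMatching}: output the size of a maximum matching of $G$. Annotated data streams: for a function $F$ of a stream $\mathbf x\in\mathcal U^m$, a scheme is a pair $(\mathfrak h,V)$ where $\mathfrak h_i:\mathcal U^m\to\{0,1\}^*$ is the prover's annotation inserted after token $x_i$, and $V$ is a single-pass streaming algorithm with a private random string reading the annotated stream and outputting a value or $\bot$. Online: $\mathfrak h_i$ depends only on $x_1,\dots,x_i$. Completeness: with the honest annotation, $V$ outputs $F(\mathbf x)$ except with probability $\le\delta_c$. Soundness: for every annotation, $V$ outputs a value outside $\{F(\mathbf x),\bot\}$ with probability $\le\delta_s$. Error $=\max(\delta_s,\delta_c)$. Help cost $=\max_{\mathbf x}\sum_i|\mathfrak h_i(\mathbf x)|$; space cost = bits of memory used by $V$. *)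

(* Defs.v *)
From HB Require Import structures.
From mathcomp Require Import all_boot all_order all_algebra.
Set Implicit Arguments. Unset Strict Implicit. Unset Printing Implicit Defensive.
Import Order.TTheory GRing.Theory Num.Theory.

(* A stream token: undirected pair {u,v} encoded as (u,v) with u < v, and an
   integer update Delta. *)
Definition token (n : nat) : Type := ('I_n * 'I_n * int)%type.

Definition valid_tok (n : nat) (t : token n) : bool := (val t.1.1 < val t.1.2)%N.

Definition mult (n : nat) (x : seq (token n)) (u v : 'I_n) : int :=
  (\sum_(t <- x | (t.1.1 == u) && (t.1.2 == v)) t.2)%R.

Definition valid_stream (n B : nat) (x : seq (token n)) : bool :=
  all (@valid_tok n) x &&
  [forall u : 'I_n, forall v : 'I_n,
     (val u < val v)%N ==> ((0 <= mult x u v)%R && (mult x u v <= B%:Z)%R)].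

Definition edgeG (n : nat) (x : seq (token n)) (u v : 'I_n) : bool :=
  (val u < val v)%N && (0 < mult x u v)%R.

Definition is_matching (n : nat) (x : seq (token n)) (M : {set 'I_n * 'I_n}) : bool :=
  [forall e in M, edgeG x e.1 e.2] &&
  [forall e in M, forall f in M,
     (e != f) ==> [&& e.1 != f.1, e.1 != f.2, e.2 != f.1 & e.2 != f.2]].

Definition max_matching (n : nat) (x : seq (token n)) : nat :=
  \max_(M : {set 'I_n * 'I_n} | is_matching x M) #|M|.

(* A single-pass streaming verifier with finite memory V_state (space cost =
   ceil(log2 #states) bits); its private random string is drawn uniformly from
   the nonempty finite type V_rand and loaded into memory by V_init.  It reads
   stream tokens (V_tok) and annotation bits (V_bit); V_out returns a value
   (Some k) or bottom (None). *)
Record verifier (n : nat) := Verifier {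
  V_state : finType;
  V_rand : finType;
  V_init : V_rand -> V_state;
  V_tok : V_state -> token n -> V_state;
  V_bit : V_state -> bool -> V_state;
  V_out : V_state -> option nat }.

Definition V_run (n : nat) (V : verifier n) (r : V_rand V)
    (x : seq (token n)) (ann : seq (seq bool)) : option nat :=
  V_out (foldl (fun s p => foldl (@V_bit n V) (V_tok s p.1) p.2)
               (V_init r) (zip x ann)).

(* online honest annotation: h_i depends only on x_1..x_i *)
Definition honest_ann (n : nat) (h : seq (token n) -> seq bool) (x : seq (token n))
  : seq (seq bool) := [seq h (take i.+1 x) | i <- iota 0 (size x)].

Definition help_cost (n : nat) (h : seq (token n) -> seq bool) (x : seq (token n)) : nat :=
  sumn [seq size a | a <- honest_ann h x].

Definition space_cost (n : nat) (V : verifier n) : nat := up_log 2 #|V_state V|.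

(* error at most 1/3: completeness (honest prover) and soundness (any
   annotation), over valid streams of length m; probabilities are over the
   uniform random string. *)
Definition online_scheme_maxmatching (n B m : nat) (V : verifier n)
    (h : seq (token n) -> seq bool) : Prop :=
  (0 < #|V_rand V|)%N /\
  (forall x : seq (token n), size x = m -> valid_stream B x ->
     (3 * #|[set r : V_rand V | V_run r x (honest_ann h x) != Some (max_matching x)]|
        <= #|V_rand V|)%N) /\
  (forall x : seq (token n), size x = m -> valid_stream B x ->
   forall ann : seq (seq bool), size ann = m ->
     (3 * #|[set r : V_rand V | if V_run r x ann is Some k then k != max_matching x
                                else false]| <= #|V_rand V|)%N).

(* Main.v *)
Require Import Defs.
From HB Require Import structures.
From mathcomp Require Import all_boot all_order all_algebra.
From mathcomp Require Import zify.
Set Implicit Arguments. Unset Strict Implicit. Unset Printing Implicit Defensive.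
Import Order.TTheory GRing.Theory Num.Theory.

(** The size of a maximum matching is certified from below by a matching M and
    from above by a vertex set U and a labelling c such that every edge avoiding
    U has equally labelled ends: then no matching has more than
    |U| + sum_k floor(|c^-1(k) \ U| / 2) edges, and by the Tutte-Berge formula
    some (U, c) attains this bound.

    Over F_p, with p > nB prime and polynomial in n, the verifier draws a random
    point r and maintains, for every vertex v, the value at r of the polynomial
    interpolating u |-> mult(u, v).  For any G revealed after the stream, the
    prover can then send the polynomial of degree less than 2n whose value at
    each vertex u is sum_v mult(u, v) G(u, v), and the verifier checks it at r.
    Taking G to be the indicator of M shows that the edges of M are present;
    taking G to be the indicator of the pairs outside U with different labels
    shows that no such edge is present, because multiplicities are nonnegative
    and a row sum is at most nB < p.  Everything fits in O(n log p) bits. *)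

(** * Central binomial coefficients and a prime of polynomial size *)

(** By Legendre's formula the exponent is the sum over k >= 1 of floor(2n/p^k) - 2 floor(n/p^k);
    each term is at most 1 and vanishes once p^k > 2n. *)
Lemma logn_central_bin p n : prime p -> (0 < n)%N ->
  (logn p 'C(n.*2, n) <= trunc_log p n.*2)%N.
Proof.
move=> p_pr n_gt0.
have n2_gt0 : (0 < n.*2)%N by rewrite double_gt0.
have p_gt1 := prime_gt1 p_pr.
have len : (n <= n.*2)%N by rewrite -addnn leq_addr.
have bin_gt : (0 < 'C(n.*2, n))%N by rewrite bin_gt0.
have := congr1 (logn p) (bin_fact len).
have -> : (n.*2 - n = n)%N by rewrite -addnn addnK.
rewrite !lognM ?muln_gt0 ?fact_gt0 // !logn_fact //.
set s := trunc_log p n.*2.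
have small j k : (j <= n.*2)%N -> (s < k)%N -> (j %/ p ^ k = 0)%N.
  move=> jn sk; apply/divn_small/(leq_ltn_trans jn).
  exact: leq_trans (trunc_log_ltn _ p_gt1) (leq_pexp2l (ltnW p_gt1) sk).
have s_le : (s <= n.*2)%N.
  rewrite -ltnS; apply: leq_trans (ltn_expl s p_gt1) _.
  by rewrite leqW // trunc_logP.
have cut j : (j <= n.*2)%N ->
    (\sum_(1 <= k < n.*2.+1) j %/ p ^ k = \sum_(1 <= k < s.+1) j %/ p ^ k)%N.
  move=> jn; rewrite (big_cat_nat (n := s.+1)) //= ?ltnS //.
  rewrite -[RHS]addn0; congr addn; rewrite big_nat big1 // => k /andP[sk _].
  exact: small.
have cutn : (\sum_(1 <= k < n.+1) n %/ p ^ k = \sum_(1 <= k < n.*2.+1) n %/ p ^ k)%N.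
  rewrite [RHS](big_cat_nat (n := n.+1)) //= ?ltnS //.
  rewrite -[LHS]addn0; congr addn; rewrite big_nat big1 // => k /andP[nk _].
  apply/divn_small/(leq_trans (ltn_expl n p_gt1)).
  by rewrite leq_exp2l // ltnW.
rewrite cutn !cut // -big_split /=.
move=> eqn; rewrite -(leq_add2r (\sum_(1 <= k < s.+1) (n %/ p ^ k + n %/ p ^ k))) eqn.
apply: leq_trans (_ : \sum_(1 <= k < s.+1) (1 + (n %/ p ^ k + n %/ p ^ k)) <= _)%N.
  apply: leq_sum => k _; have pk_gt0 : (0 < p ^ k)%N by rewrite expn_gt0 prime_gt0.
  rewrite -ltnS ltn_divLR // -addnn.
  have := ltn_ceil n pk_gt0; rewrite mulSnr => h.
  by nia.
by rewrite big_split /= sum_nat_const_nat muln1 subn1.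
Qed.

Lemma central_bin_ge n : (2 ^ n <= 'C(n.*2, n))%N.
Proof.
elim: n => [|n IHn] //.
rewrite doubleS binS expnS.
have -> : 'C(n.*2.+1, n) = 'C(n.*2.+1, n.+1).
  rewrite -bin_sub; last by rewrite -addnn -addnS leq_addr.
  by congr ('C(_, _)); rewrite -addnn; lia.
by rewrite addnn -mul2n leq_mul2l /= binS (leq_trans IHn) ?leq_addl.
Qed.

Lemma central_bin_le n : (0 < n)%N ->
  ('C(n.*2, n) <= n.*2 ^ size (primes 'C(n.*2, n)))%N.
Proof.
move=> n_gt0.
have bin_gt : (0 < 'C(n.*2, n))%N by rewrite bin_gt0 -addnn leq_addr.
rewrite {1}[X in (X <= _)%N]prod_prime_decomp // prime_decompE big_map /=.
rewrite -[X in (_ <= n.*2 ^ X)%N]sum1_size expn_sum.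
rewrite big_seq [X in (_ <= X)%N]big_seq; apply: leq_prod => p.
rewrite mem_primes => /andP[p_pr _].
have n2_gt0 : (0 < n.*2)%N by rewrite double_gt0.
apply: leq_trans (trunc_logP (prime_gt1 p_pr) n2_gt0).
by rewrite leq_exp2l ?prime_gt1 // logn_central_bin.
Qed.

(* If every prime factor of C(2n, n) were at most N, that number would be at
   most (2n)^N, which is less than 2^n for n of order N^2. *)
Lemma prime_between a N : (N <= 2 ^ a)%N ->
  exists2 p, prime p & (N < p <= 2 ^ (a.*2 + 3))%N.
Proof.
move=> leN; pose n := (2 ^ (a.*2 + 2))%N.
have n_gt0 : (0 < n)%N by rewrite expn_gt0.
have n2E : n.*2 = (2 ^ (a.*2 + 3))%N by rewrite addnS expnS mul2n.
have bin_gt : (0 < 'C(n.*2, n))%N by rewrite bin_gt0 -addnn leq_addr.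
case: (altP (allP (a := leq^~ N) (s := primes 'C(n.*2, n)))) => [small|/allPn[p pP]].
  have szP : (size (primes 'C(n.*2, n)) <= N)%N.
    rewrite -[X in (_ <= X)%N](size_iota 1); apply: uniq_leq_size; first exact: primes_uniq.
    move=> p pP; rewrite mem_iota add1n ltnS small // andbT.
    by move: pP; rewrite mem_primes => /andP[/prime_gt0].
  have := leq_trans (central_bin_ge n) (central_bin_le n_gt0).
  move: szP; set s := size _ => szP; rewrite leqNgt => /negP[].
  rewrite n2E -expnM ltn_exp2l //.
  (* As [n] is 4 * 2^a * 2^a, it remains to see that 2a + 3 < 4 * 2^a. *)
  apply: leq_ltn_trans (_ : (a.*2 + 3) * 2 ^ a < _)%N.
    by rewrite leq_mul2l (leq_trans szP leN) orbT.
  have -> : n = (2 ^ a.+2 * 2 ^ a)%N by rewrite -expnD; congr (2 ^ _)%N; lia.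
  rewrite ltn_pmul2r ?expn_gt0 //.
  by elim: (a) => [|b IHb] //; rewrite expnS; lia.
rewrite /= -ltnNge => ltNp.
move: pP; rewrite mem_primes => /and3P[p_pr _ p_dvd].
exists p => //; rewrite ltNp /= -n2E.
have : (0 < logn p 'C(n.*2, n))%N by rewrite logn_gt0 mem_primes p_pr bin_gt p_dvd.
move/leq_trans/(_ (logn_central_bin p_pr n_gt0)) => tl.
have n2_gt0 : (0 < n.*2)%N by rewrite double_gt0.
apply: leq_trans (trunc_logP (prime_gt1 p_pr) n2_gt0).
by rewrite -{1}(expn1 p) leq_exp2l ?prime_gt1.
Qed.

(** * The Tutte-Berge formula through Gallai's lemma *)

Section TutteBerge.
Variable T : finType.
Implicit Types (E M N : {set {set T}}) (U A : {set T}) (c : T -> T).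

Definition graph E := [forall e in E, #|e| == 2].

Definition matching E M := (M \subset E) && trivIset M.

Definition maximum E M :=
  matching E M && [forall N, matching E N ==> (#|N| <= #|M|)].

Definition separated E U c :=
  [forall e in E, [disjoint e & U] ==>
     [forall u in e, forall v in e, c u == c v]].

Definition block U c k := [set v | v \notin U & c v == k].

(** The Tutte-Berge bound with arbitrary label classes in place of the components left after
    deleting [U]; vertices serve as labels. *)
Definition berge U c := #|U| + \sum_k #|block U c k|./2.

Lemma separatedP E U c :
  reflect (forall e u v, e \in E -> [disjoint e & U] -> u \in e -> v \in e -> c u = c v)
          (separated E U c).
Proof.
apply: (iffP forall_inP) => [sep e u v eE dis ue ve|sep e eE].
  by have /implyP/(_ dis)/forall_inP/(_ u ue)/forall_inP/(_ v ve)/eqP := sep e eE.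
apply/implyP => dis; apply/forall_inP => u ue; apply/forall_inP => v ve.
exact/eqP/(sep e).
Qed.

Lemma trivIset_sum_card M A : trivIset M -> \sum_(e in M) #|e :&: A| <= #|A|.
Proof.
move=> tM.
rewrite (eq_bigr (fun e : {set T} => \sum_(x in e) (x \in A : nat))) => [|e _]; last first.
  by rewrite -sum1_card big_mkcond [RHS]big_mkcond; apply: eq_bigr => x _;
     rewrite inE; do 2 case: (x \in _).
rewrite -(big_trivIset _ tM) /= -sum1_card big_mkcond [X in _ <= X]big_mkcond.
by apply: leq_sum => x _; do 2 case: (x \in _).
Qed.

Lemma trivIset_meet_eq M e f x :
  trivIset M -> e \in M -> f \in M -> x \in e -> x \in f -> e = f.
Proof.
move=> /trivIsetP tM eM fM xe xf; apply/eqP/negPn/negP => ef.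
by have := disjointFr (tM _ _ eM fM ef) xe; rewrite xf.
Qed.

Lemma notin_coverP M x : reflect {in M, forall e : {set T}, x \notin e} (x \notin cover M).
Proof.
apply: (iffP idP) => [xM e eM|xM].
  by apply: contra xM => xe; apply/bigcupP; exists e.
by apply/negP => /bigcupP[e /xM/negP].
Qed.

Lemma card_cover_matching E M : graph E -> matching E M -> #|cover M| = #|M|.*2.
Proof.
move=> /forall_inP gE /andP[/subsetP sM /eqP <-].
rewrite (eq_bigr (fun=> 2)) => [|e /sM/gE/eqP //].
by rewrite sum_nat_const muln2.
Qed.

Lemma matching_add E M e : matching E M -> e \in E ->
  (forall f, f \in M -> [disjoint e & f]) -> matching E (e |: M).
Proof.
move=> /andP[sM /trivIsetP tM] eE dis; apply/andP; split.
  by rewrite subUset sub1set eE.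
apply/trivIsetP => f g /setU1P[->|fM] /setU1P[->|gM]; rewrite ?eqxx // => fg.
- exact: dis.
- by rewrite disjoint_sym dis.
- exact: tM.
Qed.

Lemma matching_sub E M N : matching E M -> N \subset M -> matching E N.
Proof.
by case/andP => sM tM sN; rewrite /matching (subset_trans sN sM) (trivIsetS sN).
Qed.

(** An edge meeting [U] is charged to a vertex of [U]; any other has equally labelled ends, hence
    lies in one block, and disjoint edges within a block number at most half its size. *)
Lemma matching_le_berge E M U c :
  graph E -> separated E U c -> matching E M -> #|M| <= berge U c.
Proof.
move=> /forall_inP gE /separatedP sep /andP[/subsetP sM tM].
rewrite /berge; set F := fun k => [set e in M | e \subset block U c k].
have leF k : #|F k| <= #|block U c k|./2.
  rewrite -(doubleK #|F k|) half_leq // -muln2 -sum_nat_const.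
  have tF : trivIset (F k) by apply: trivIsetS tM; apply/subsetP => e /[!inE]/andP[].
  apply: leq_trans (trivIset_sum_card _ tF); apply: leq_sum => e.
  by rewrite inE => /andP[/sM/gE/eqP eE /setIidPl ->]; rewrite eE.
apply: leq_trans (leq_add (trivIset_sum_card U tM) (leq_sum _ (fun k _ => leF k))).
rewrite (eq_bigr (fun k => \sum_(e in M) (e \subset block U c k))) => [|k _]; last first.
  rewrite -sum1_card big_mkcond [RHS]big_mkcond; apply: eq_bigr => e _.
  by rewrite inE; case: (e \in M); case: (e \subset _).
rewrite exchange_big -big_split -sum1_card /=; apply: leq_sum => e eM.
case: (posnP #|e :&: U|) => [/eqP|e_gt0]; last exact: ltn_addr.
rewrite cards_eq0 setI_eq0 => dis; apply: ltn_addl.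
have /card_gt0P[x xe] : 0 < #|e| by rewrite (eqP (gE _ (sM _ eM))).
rewrite (bigD1 (c x)) //= (_ : e \subset _) //.
apply/subsetP => y ye; rewrite inE (disjointFr dis ye) /=.
exact/eqP/(sep e y x (sM _ eM)).
Qed.

Lemma maximumP E M : reflect (matching E M /\ forall N, matching E N -> #|N| <= #|M|)
  (maximum E M).
Proof.
apply: (iffP andP) => -[mM /= maxM]; split => //.
  by move=> N; exact: (implyP (forallP maxM N)).
by apply/forallP => N; apply/implyP/maxM.
Qed.

Lemma maximum_exists E : exists M, maximum E M.
Proof.
have m0 : matching E set0.
  by rewrite /matching sub0set; apply/trivIsetP => ? ?; rewrite inE.
case: (arg_maxnP (fun M : {set {set T}} => #|M|) m0) => M mM maxM.
by exists M; apply/maximumP.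
Qed.

Lemma maximum_card E M N : maximum E M -> maximum E N -> #|M| = #|N|.
Proof.
case/maximumP => mM maxM /maximumP[mN maxN].
by apply/eqP; rewrite eqn_leq maxN ?maxM.
Qed.

Definition jointly_missed E u v :=
  [exists M, [&& maximum E M, u \notin cover M & v \notin cover M]].

(** When every vertex is missed by some maximum matching, this is an equivalence relation, and its
    classes serve as the blocks. *)
Definition gallai E u v := (u == v) || ~~ jointly_missed E u v.

Lemma gallai_sym E : symmetric (gallai E).
Proof.
move=> u v; rewrite /gallai eq_sym; congr (_ || ~~ _).
by apply/existsP/existsP => -[M /and3P[? ? ?]]; exists M; apply/and3P.
Qed.

(** A maximum matching missing both ends of an edge could be enlarged by it. *)
Lemma gallai_adj E e u v : graph E -> e \in E -> u \in e -> v \in e -> gallai E u v.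
Proof.
move=> /forall_inP gE eE ue ve; rewrite /gallai.
case: eqVneq => //= uv; apply/negP => /existsP[M /and3P[/maximumP[mM maxM]]].
move=> /notin_coverP uM /notin_coverP vM.
have eM : e \notin M by apply: contraL ue => /uM.
have e2 : e = [set u; v].
  apply/esym/eqP; rewrite eqEcard cards2 uv (eqP (gE e eE)) leqnn andbT.
  by rewrite subUset !sub1set ue ve.
suff /maxM : matching E (e |: M) by rewrite cardsU1 eM add1n ltnn.
apply: matching_add => // f fM; rewrite e2 disjoint_subset; apply/subsetP => x; rewrite !inE.
by case/orP => /eqP ->; [apply: uM|apply: vM].
Qed.

(* Gallai's lemma.  Among the maximum matchings N missing t take one that
   shares most edges with a maximum matching M missing u and v; as N covers u
   and v, M covers some x <> t missed by N, and exchanging the M-edge at x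
   into N contradicts the choice of N. *)
Lemma gallai_trans E t u v : graph E ->
  (exists2 M, maximum E M & t \notin cover M) ->
  gallai E u t -> gallai E t v -> gallai E u v.
Proof.
move=> gE [N0 maxN0 tN0]; rewrite {1}/gallai; case: eqVneq => [-> //|ut /= nut].
rewrite {1}/gallai; case: eqVneq => [<- _|tv /= ntv].
  by rewrite /gallai nut orbT.
rewrite /gallai; case: eqVneq => //= uv; apply/negP => /existsP[M /and3P[maxM uM vM]].
pose P N := maximum E N && (t \notin cover N).
have P0 : P N0 by apply/andP.
case: (arg_maxnP (fun N => #|M :&: N|) P0) => N /andP[maxN tN] bestN.
have uN : u \in cover N.
  by apply: contraNT nut => uN; apply/existsP; exists N; apply/and3P.
have vN : v \in cover N.
  by apply: contraNT ntv => vN; apply/existsP; exists N; apply/and3P.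
have [mM _] := maximumP _ _ maxM; have [mN topN] := maximumP _ _ maxN.
have [sM tM] := andP mM; have [sN trN] := andP mN.
have cardC : #|cover M| = #|cover N|.
  by rewrite !(card_cover_matching gE) // (maximum_card maxM maxN).
(* Covers of maximum matchings have equal size, so the vertices [u] and [v] that only [N] covers are
   balanced by at least two that only [M] covers, one of them not [t]. *)
have le2 : 2 <= #|cover N :\: cover M|.
  have <- : #|[set u; v]| = 2 by rewrite cards2 uv.
  by apply: subset_leq_card; rewrite subUset !sub1set !inE uN vN uM vM.
have le2' : 2 <= #|cover M :\: cover N|.
  by move: le2; rewrite !cardsD cardC setIC.
have /card_gt0P[x] : 0 < #|(cover M :\: cover N) :\ t|.
  have := cardsD1 t (cover M :\: cover N); move: le2'; case: (t \in _) => /=;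
  by case: #|_ :\ t| => // + E1; rewrite E1.
rewrite !inE => /and3P[xt xN /bigcupP[e eM xe]].
have eE : e \in E by apply: (subsetP sM).
have eN : e \notin N by apply: contraL xe => /(notin_coverP _ _ xN).
have [y ye yN] : exists2 y, y \in e & y \in cover N.
  apply/exists_inP; apply: contraT => /exists_inPn yN.
  suff /topN : matching E (e |: N) by rewrite cardsU1 eN add1n ltnn.
  apply: matching_add => // f fN.
  rewrite disjoint_subset; apply/subsetP => y /yN /notin_coverP; exact.
have /bigcupP[f fN yf] := yN.
have xy : x != y by apply: contraNneq xN => ->.
have e2 : e = [set x; y].
  apply/esym/eqP; rewrite eqEcard cards2 xy (eqP (forall_inP gE e eE)) leqnn andbT.
  by rewrite subUset !sub1set xe ye.
have fM : f \notin M.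
  apply/negP => fM; have fe := trivIset_meet_eq tM fM eM yf ye.
  by rewrite fe (negPf eN) in fN.
pose N' := e |: (N :\ f).
have mN' : matching E N'.
  apply: matching_add => //; first exact: matching_sub mN (subD1set _ _).
  move=> g /setD1P[gf gN]; rewrite e2 disjoint_subset; apply/subsetP => z.
  rewrite !inE => /orP[] /eqP ->; first exact: (notin_coverP _ _ xN).
  by apply: contra gf => yg; apply/eqP/(trivIset_meet_eq trN gN fN yg yf).
have cardN' : #|N'| = #|N|.
  by rewrite cardsU1 !inE (negPf eN) andbF add1n (cardsD1 f N) fN.
have PN' : P N'.
  apply/andP; split; first by apply/maximumP; split => // M' /topN; rewrite cardN'.
  apply/notin_coverP => g; rewrite !inE => /orP[/eqP ->|/andP[_ gN]]; last first.
    exact: (notin_coverP _ _ tN).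
  rewrite e2 !inE negb_or (eq_sym t x) xt /=.
  by apply: contraNneq tN => ->.
(* [N'] trades [f], outside [M], for [e], inside [M], so it shares one more edge with [M]. *)
have := bestN N' PN'; rewrite /= leqNgt => /negP; apply.
apply: leq_trans (_ : #|e |: (M :&: N)| <= _).
  by rewrite cardsU1 !inE (negPf eN) andbF.
apply/subset_leq_card/subsetP => g; rewrite !inE => /orP[/eqP ->|/andP[gM gN]].
  by rewrite eM eqxx.
rewrite gM gN andbT /=; apply/orP; right.
by apply: contraNneq fM => <-.
Qed.

(** Induction on the number of edges. If every vertex is missed by some maximum matching, [U] is
    empty and the blocks are the classes of [gallai]. Otherwise a vertex [v] covered by all maximum
    matchings goes into [U], and removing its edges lowers the matching number. *)
Lemma tutte_berge E : graph E ->
  exists U c M, [/\ matching E M, separated E U c & #|M| = berge U c].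
Proof.
move=> gE; suff [U [c [M [mM sep le]]]] : exists U c M,
    [/\ matching E M, separated E U c & berge U c <= #|M|].
  exists U, c, M; split => //; apply/eqP.
  by rewrite eqn_leq le andbT (matching_le_berge gE sep mM).
have [m] := ubnP #|E|; elim: m => // m IHm in E gE *; rewrite ltnS => leE.
have [miss|] := boolP [forall v, [exists M, maximum E M && (v \notin cover M)]].
  have [M maxM] := maximum_exists E.
  have {}miss t : exists2 M, maximum E M & t \notin cover M.
    by have /existsP[M' /andP[? ?]] := forallP miss t; exists M'.
  pose c u := odflt u [pick w | gallai E u w].
  have cP u : gallai E u (c u).
    by rewrite /c; case: pickP => [//|] /(_ u); rewrite /gallai eqxx.
  have cE u v : gallai E u v -> c u = c v.
    move=> uv; rewrite /c.
    have eqP : gallai E u =1 gallai E v.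
      move=> w; apply/idP/idP; apply: gallai_trans => //.
      by rewrite gallai_sym.
    rewrite (eq_pick eqP); case: pickP => [//|] /(_ v).
    by rewrite /gallai eqxx.
  have [mM topM] := maximumP _ _ maxM; have [sM tM] := andP mM.
  exists set0, c, M; split => //.
    by apply/separatedP => e u v eE _ ue ve; apply/cE/(gallai_adj gE eE).
  rewrite /berge cards0 add0n.
  pose F k := [set e in M | e \subset block set0 c k].
  (* Edges never leave a class and [M] misses at most one vertex of it, so [M] has at least half its
     size, rounded down, in edges inside. *)
  have leF k : #|block set0 c k|./2 <= #|F k|.
    have FE : block set0 c k :&: cover M = cover (F k).
      apply/setP => x; rewrite !inE /=; apply/andP/bigcupP.
        move=> [cx /bigcupP[e eM xe]]; exists e => //; rewrite inE eM /=.
        apply/subsetP => y ye; rewrite !inE -(eqP cx) /=; apply/eqP/cE.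
        exact: gallai_adj (subsetP sM _ eM) ye xe.
      move=> [e]; rewrite inE => /andP[eM /subsetP se xe].
      by have := se _ xe; rewrite !inE /= => ->; split => //; apply/bigcupP; exists e.
    have mF : matching E (F k).
      by apply: matching_sub mM _; apply/subsetP => e /[!inE]/andP[].
    rewrite -(cardsID (cover M)) FE (card_cover_matching gE mF).
    have : #|block set0 c k :\: cover M| <= 1.
      apply/card_le1_eqP => u v; rewrite !inE /= => /andP[uM /eqP cu] /andP[vM /eqP cv].
      have : gallai E u v.
        by apply: gallai_trans (cP u) _ => //; rewrite cu -cv gallai_sym.
      case/orP => [/eqP //|/negP[]].
      by apply/existsP; exists M; rewrite maxM uM vM.
    case: #|_| => [|[|//]] _; first by rewrite addn0 doubleK.
    by rewrite addn1 /= uphalf_double.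
  apply: leq_trans (leq_sum _ (fun k _ => leF k)) _.
  rewrite (eq_bigr (fun k => \sum_(e in M) (e \subset block set0 c k))) => [|k _]; last first.
    rewrite -sum1_card big_mkcond [RHS]big_mkcond; apply: eq_bigr => e _.
    by rewrite inE; case: (e \in M); case: (e \subset _).
  rewrite exchange_big -sum1_card /=; apply: leq_sum => e eM.
  have /card_gt0P[x xe] : 0 < #|e| by rewrite (eqP (forall_inP gE _ (subsetP sM _ eM))).
  rewrite (bigD1 (c x)) //= big1 ?addn0 ?leq_b1 // => k kc.
  case: (boolP (_ \subset _)) => // /subsetP/(_ x xe); rewrite !inE /= => /eqP ck.
  by rewrite ck eqxx in kc.
case/forallPn => v /existsPn cov.
pose E' := [set e in E | v \notin e].
have [M maxM] := maximum_exists E.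
have vM : v \in cover M by have := cov M; rewrite maxM negbK.
have ltE : #|E'| < m.
  apply: leq_trans leE; apply/proper_card/properP; split.
    by apply/subsetP => e /[!inE]/andP[].
  have /bigcupP[e eM ve] := vM; have [/andP[sM _] _] := maximumP _ _ maxM.
  by exists e; rewrite ?inE ?ve ?andbF // (subsetP sM).
have gE' : graph E'.
  by apply/forall_inP => e; rewrite inE => /andP[/(forall_inP gE)].
have [U [c [M' [mM' /separatedP sep le]]]] := IHm E' gE' ltE.
have mM'E : matching E M'.
  case/andP: mM' => sM' tM'; rewrite /matching tM' andbT (subset_trans sM') //.
  by apply/subsetP => e /[!inE]/andP[].
exists (v |: U), c, M; split; first by case/maximumP: maxM.
  apply/separatedP => e x y eE dis; apply: sep.
    by rewrite inE eE (disjointFl dis) ?setU11.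
  exact: disjointWr (subsetUr _ _) dis.
have ltM : #|M'| < #|M|.
  rewrite ltn_neqAle; have [_ topM] := maximumP _ _ maxM; rewrite topM // andbT.
  apply/negP => /eqP eqM.
  have maxM' : maximum E M' by apply/maximumP; split => // N /topM; rewrite eqM.
  have := cov M'; rewrite maxM' negbK /= => /bigcupP[e eM'].
  by case/andP: mM' => /subsetP/(_ _ eM'); rewrite inE => /andP[_ /negPf ->].
apply: leq_trans ltM; rewrite -addn1 addnC; apply: leq_trans (leq_add (leqnn 1) le).
rewrite addnA leq_add //; first by rewrite cardsU1; case: (v \in U).
apply: leq_sum => k _; apply/half_leq/subset_leq_card/subsetP => x.
by rewrite !inE negb_or => /andP[/andP[_ ->]].
Qed.

End TutteBerge.

(** * The graph of a stream and its matchings *)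

Section StreamGraph.
Variable n : nat.
Implicit Types (x : seq (token n)) (e f : 'I_n * 'I_n) (M : {set 'I_n * 'I_n}).

Definition ends e : {set 'I_n} := [set e.1; e.2].

Definition edges x := ends @: [set e : 'I_n * 'I_n | edgeG x e.1 e.2].

Definition pairwise_disjoint M := [forall e in M, forall f in M,
  (e != f) ==> [&& e.1 != f.1, e.1 != f.2, e.2 != f.1 & e.2 != f.2]].

(** Coding a matching by a function on vertices costs about n log n bits rather than one bit per
    pair. Each edge is listed once, from its smaller end. *)
Definition partner_pairs (P : {ffun 'I_n -> 'I_n}) : {set 'I_n * 'I_n} :=
  [set e : 'I_n * 'I_n | (e.1 < e.2) && (P e.1 == e.2)].

Lemma ends_inj e f : e.1 < e.2 -> f.1 < f.2 -> ends e = ends f -> e = f.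
Proof.
case: e f => [a b] [a' b'] /= ab ab' /setP eqE.
have := eqE a; have := eqE b; rewrite !inE !eqxx orbT /=.
move=> /esym/orP[]/eqP/(congr1 val)/= bE /esym/orP[]/eqP/(congr1 val)/= aE; try lia.
by congr pair; apply: val_inj.
Qed.

Lemma graph_edges x : graph (edges x).
Proof.
apply/forall_inP => _ /imsetP[e + ->]; rewrite inE => /andP[e12 _].
by rewrite cards2 (_ : e.1 != e.2) //; apply: contraTneq e12 => ->; rewrite ltnn.
Qed.

Lemma ends_disjoint e f :
  [disjoint ends e & ends f] = [&& e.1 != f.1, e.1 != f.2, e.2 != f.1 & e.2 != f.2].
Proof.
by rewrite disjoints_subset {1}/ends subUset !sub1set !inE !negb_or -!andbA.
Qed.

Lemma separated_edges x (U : {set 'I_n}) (c : 'I_n -> 'I_n) :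
  reflect (forall u v, edgeG x u v -> u \notin U -> v \notin U -> c u = c v)
          (separated (edges x) U c).
Proof.
apply: (iffP (separatedP _ _ _)) => [sep u v uv uU vU|sep _ u v /imsetP[e eG ->] dis].
  apply: (sep (ends (u, v))); rewrite ?inE ?eqxx ?orbT //.
    by apply: imset_f; rewrite inE.
  by rewrite disjoints_subset {1}/ends subUset !sub1set !inE uU vU.
have cE : c e.1 = c e.2.
  by apply: sep; [rewrite inE in eG| |]; rewrite ?(disjointFr dis) ?inE ?eqxx ?orbT.
by rewrite !inE => /orP[]/eqP -> /orP[]/eqP ->; rewrite ?cE.
Qed.

Lemma matching_of_pairs x M : is_matching x M ->
  matching (edges x) (ends @: M) /\ #|ends @: M| = #|M|.
Proof.
case/andP => /forall_inP sM /forall_inP dM; split.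
  apply/andP; split; first by apply/imsetS/subsetP => e /sM; rewrite inE.
  apply/trivIsetP => _ _ /imsetP[e eM ->] /imsetP[f fM ->] ef.
  have /forall_inP/(_ f fM)/implyP := dM e eM; rewrite ends_disjoint; apply.
  by apply: contraNneq ef => ->.
apply: card_in_imset => e f /sM/andP[? _] /sM/andP[? _]; exact: ends_inj.
Qed.

Lemma pairs_of_matching x (N : {set {set 'I_n}}) : matching (edges x) N ->
  exists P, is_matching x (partner_pairs P) /\ #|partner_pairs P| = #|N|.
Proof.
case/andP => /subsetP sN /trivIsetP tN.
pose M := [set e : 'I_n * 'I_n | edgeG x e.1 e.2 & ends e \in N].
have ltM e : e \in M -> e.1 < e.2 by rewrite inE => /andP[/andP[]].
have imM : ends @: M = N.
  apply/setP => e; apply/imsetP/idP => [[f + ->]|eN]; first by rewrite inE => /andP[].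
  have /imsetP[f fG eE] := sN e eN; exists f => //.
  by move: fG; rewrite !inE => ->; rewrite -eE.
have disM e f : e \in M -> f \in M -> e != f -> [disjoint ends e & ends f].
  move=> eM fM ef; apply: tN; rewrite -?imM ?imset_f //.
  by apply: contraNneq ef => /(ends_inj (ltM _ eM) (ltM _ fM)) ->.
have mM : is_matching x M.
  apply/andP; split; first by apply/forall_inP => e; rewrite inE => /andP[].
  apply/forall_inP => e eM; apply/forall_inP => f fM; apply/implyP => ef.
  by rewrite -ends_disjoint disM.
(* A vertex that is not the smaller end of a pair is sent to itself, which yields no pair. *)
pose P := [ffun u => odflt u [pick v | (u, v) \in M]].
have PM : partner_pairs P = M.
  apply/setP => -[u v]; rewrite inE /= ffunE; apply/andP/idP => [[]|uvM].
    by case: pickP => [w wM _ /eqP <- //|_ /=]; move=> + /eqP uv; rewrite uv ltnn.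
  split; first exact: ltM uvM.
  case: pickP => [w /= wM|/(_ v)]; last by rewrite uvM.
  apply: contraT => wv; have := disM _ _ wM uvM; rewrite ends_disjoint eqxx /=.
  by apply; apply: contraNneq wv => -[->].
exists P; rewrite PM; split => //.
by rewrite -(proj2 (matching_of_pairs mM)) imM.
Qed.

Lemma max_matching_berge x M U c :
  is_matching x M -> separated (edges x) U c -> #|M| = berge U c ->
  max_matching x = #|M|.
Proof.
move=> mM sep ME; apply/eqP; rewrite eqn_leq; apply/andP; split.
  apply/bigmax_leqP => N /matching_of_pairs[mN <-].
  by rewrite ME (matching_le_berge (graph_edges x)).
exact: leq_bigmax_cond.
Qed.

Lemma max_matching_witness x : exists U c P,
  [/\ is_matching x (partner_pairs P), separated (edges x) U c
    & #|partner_pairs P| = berge U c].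
Proof.
have [U [c [N [mN sep NE]]]] := tutte_berge (graph_edges x).
have [P [mP PE]] := pairs_of_matching mN.
by exists U, c, P; rewrite PE.
Qed.

(** Validity bounds only the pairs with u < v; no valid token contributes to the others, so their
    multiplicity is zero. *)
Lemma mult_bounds B x u v : valid_stream B x ->
  (0 <= mult x u v)%R /\ (mult x u v <= B%:Z)%R.
Proof.
case/andP => /allP val_x /forallP/(_ u)/forallP/(_ v)/implyP bnd.
case: (ltnP u v) => uv; first by have /andP := bnd uv.
suff -> : mult x u v = 0%R by [].
rewrite /mult big_seq_cond big1 // => t /and3P[/val_x tv /eqP tu /eqP tw].
by move: tv; rewrite /valid_tok tu tw ltnNge uv.
Qed.

Lemma mult_cons t x u v :
  mult (t :: x) u v = ((if (t.1.1 == u) && (t.1.2 == v) then t.2 else 0) + mult x u v)%R.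
Proof. by rewrite /mult big_cons; case: ifP; rewrite ?add0r. Qed.

Lemma max_matching_trivial x : (forall u v, mult x u v = 0%R) -> max_matching x = 0.
Proof.
move=> x0; apply/eqP; rewrite -leqn0; apply/bigmax_leqP => M /andP[/forall_inP sM _].
rewrite leqn0 cards_eq0; apply/eqP/setP => e; rewrite inE.
by apply/negP => /sM; rewrite /edgeG x0 ltxx andbF.
Qed.

End StreamGraph.

(** * Lagrange interpolation and inner product polynomials *)

Section Sketch.
Local Open Scope ring_scope.
Variables (K : fieldType) (n : nat) (pts : 'I_n -> K).
Hypothesis pts_inj : injective pts.
Implicit Types (f : 'I_n -> K) (F G : 'I_n -> 'I_n -> K).

Definition lagrange_basis (u : 'I_n) : {poly K} :=
  (\prod_(w | w != u) (pts u - pts w))^-1 *: \prod_(w | w != u) ('X - (pts w)%:P).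

Definition interpolant f : {poly K} := \sum_u f u *: lagrange_basis u.

(** Multiplying column interpolants, rather than interpolating the row sums, makes the value at [r]
    depend on [F] only through its [n] column interpolants at [r]; the price is a degree of up to
    about 2n. *)
Definition inner_poly F G : {poly K} :=
  \sum_v interpolant (F^~ v) * interpolant (G^~ v).

Lemma size_interpolant f : (size (interpolant f) <= n)%N.
Proof.
apply: (big_ind (fun q : {poly K} => (size q <= n)%N)); first by rewrite size_poly0.
  by move=> q1 q2 q1n q2n; rewrite (leq_trans (size_polyD _ _)) // geq_max q1n.
move=> u _; rewrite scalerA (leq_trans (size_scale_leq _ _)) //.
rewrite -big_filter size_prod_XsubC size_filter -sum1_count sum1_card cardC1 card_ord.
by rewrite prednK // (leq_ltn_trans _ (ltn_ord u)).
Qed.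

Lemma interpolant_pts f u : (interpolant f).[pts u] = f u.
Proof.
rewrite horner_sum (bigD1 u) //= big1 ?addr0 => [|w wu].
  rewrite !hornerZ horner_prod.
  under [X in _ * (_ * X)]eq_bigr do rewrite hornerXsubC.
  rewrite mulVf ?mulr1 //; apply/prodf_neq0 => w wu.
  by rewrite subr_eq0 eq_sym (inj_eq pts_inj).
rewrite !hornerZ horner_prod [X in _ * (_ * X)](bigD1 u) 1?eq_sym //= hornerXsubC subrr.
by rewrite mul0r !mulr0.
Qed.

Lemma size_inner_poly F G : (size (inner_poly F G) <= 2 * n)%N.
Proof.
apply: (big_ind (fun q : {poly K} => (size q <= 2 * n)%N)); first by rewrite size_poly0.
  by move=> q1 q2 q1n q2n; rewrite (leq_trans (size_polyD _ _)) // geq_max q1n.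
move=> v _; rewrite (leq_trans (size_polyMleq _ _)) // mul2n -addnn.
by rewrite (leq_trans (leq_pred _)) // leq_add ?size_interpolant.
Qed.

Lemma inner_poly_pts F G u : (inner_poly F G).[pts u] = \sum_v F u v * G u v.
Proof. by rewrite horner_sum; apply: eq_bigr => v _; rewrite hornerM !interpolant_pts. Qed.

End Sketch.

(** * Certificates and their verification at a random point *)

Section Checks.
Variables (p n B : nat).
Hypotheses (p_pr : prime p) (p_ge : 6 * n <= p) (p_gt : n * B < p).
Local Open Scope ring_scope.
Implicit Types (x : seq (token n)) (r : 'F_p) (U : {set 'I_n}) (c P : {ffun 'I_n -> 'I_n}).

Definition Fpt (u : 'I_n) : 'F_p := (u : nat)%:R.

Definition Fmult x (u v : 'I_n) : 'F_p := (mult x u v)%:~R.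

Definition sketch r x : {ffun 'I_n -> 'F_p} :=
  [ffun v => (interpolant Fpt (Fmult x ^~ v)).[r]].

(** Row [u] has its single 1 at [P u], so its inner product with row [u] of the multiplicities is
    the multiplicity of ([u], [P u]). *)
Definition partner_query P (u v : 'I_n) : 'F_p := (P u == v)%:R.

Definition crossing_query U c (u v : 'I_n) : 'F_p :=
  [&& u \notin U, v \notin U & c u != c v]%:R.

Definition query_ok r (sigma : {ffun 'I_n -> 'F_p}) (G : 'I_n -> 'I_n -> 'F_p)
    (q : 'rV['F_p]_(2 * n)) : bool :=
  (rVpoly q).[r] == \sum_v sigma v * (interpolant Fpt (G^~ v)).[r].

Definition cert : finType :=
  ({set 'I_n} * {ffun 'I_n -> 'I_n} * {ffun 'I_n -> 'I_n}
     * 'rV['F_p]_(2 * n) * 'rV['F_p]_(2 * n))%type.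

Definition cert_value (ct : cert) : nat :=
  let: (_, _, P, _, _) := ct in #|partner_pairs P|.

Definition cert_ok (ct : cert) : bool :=
  let: (U, c, P, q1, q2) := ct in
  [&& pairwise_disjoint (partner_pairs P),
      [forall u : 'I_n, (u < P u)%N ==> ((rVpoly q1).[Fpt u] != 0)],
      [forall u : 'I_n, (rVpoly q2).[Fpt u] == 0]
    & #|partner_pairs P| == berge U c].

Definition cert_queries r sigma (ct : cert) : bool :=
  let: (U, c, P, q1, q2) := ct in
  query_ok r sigma (partner_query P) q1 && query_ok r sigma (crossing_query U c) q2.

Definition verdict r sigma (ct : cert) : option nat :=
  if cert_ok ct && cert_queries r sigma ct then Some (cert_value ct) else None.

Lemma nat_Fp_eq0 m : (m < p)%N -> (m%:R == 0 :> 'F_p) = (m == 0%N).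
Proof.
move=> mp; rewrite -(dvdn_pcharf (pchar_Fp p_pr)).
by apply/idP/eqP => [|-> //]; case: m mp => // m mp /(dvdn_leq (ltn0Sn _)); rewrite leqNgt mp.
Qed.

Lemma int_Fp_eq0 (z : int) : 0 <= z -> z < p%:Z -> (z%:~R == 0 :> 'F_p) = (z == 0).
Proof. by case: z => // m _ mp; rewrite -pmulrn nat_Fp_eq0. Qed.

Lemma Fpt_inj : injective Fpt.
Proof.
have lt_p (u : 'I_n) : (u < p)%N by apply: leq_trans (ltn_ord u) _; lia.
move=> u v /(congr1 (@nat_of_ord _)).
by rewrite /Fpt !val_Fp_nat // !modn_small // => /val_inj.
Qed.

Lemma sketch_query r x G :
  \sum_v sketch r x v * (interpolant Fpt (G^~ v)).[r] = (inner_poly Fpt (Fmult x) G).[r].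
Proof. by rewrite horner_sum; apply: eq_bigr => v _; rewrite ffunE hornerM. Qed.

Lemma query_ok_complete r x G :
  query_ok r (sketch r x) G (poly_rV (inner_poly Fpt (Fmult x) G)).
Proof. by rewrite /query_ok sketch_query poly_rV_K // size_inner_poly. Qed.

(** A wrong claim differs from the truth by a nonzero polynomial of size at most 2n, which has fewer
    than 2n roots, and 6n <= p. *)
Lemma query_ok_sound x G q : rVpoly q != inner_poly Fpt (Fmult x) G ->
  (3 * #|[set r | query_ok r (sketch r x) G q]| <= p)%N.
Proof.
rewrite -subr_eq0 => nz; set Q := _ - _ in nz.
have sQ : (size Q <= 2 * n)%N.
  rewrite (leq_trans (size_polyD _ _)) // size_polyN geq_max size_inner_poly.
  by rewrite (leq_trans (size_poly _ _)).
set A := [set r | _]; have : (size (enum A) < size Q)%N.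
  apply: max_poly_roots; rewrite ?enum_uniq //.
  apply/allP => r; rewrite mem_enum inE /query_ok sketch_query => /eqP rE.
  by rewrite /root hornerD hornerN rE subrr.
rewrite -cardE; lia.
Qed.

(** A nonzero value at [u] makes the multiplicity of ([u], [P u]) positive. A crossing row sum lies
    between 0 and nB < p, so if it is zero modulo p it is zero as an integer, and none of its
    nonnegative terms comes from an edge. *)
Lemma exact_cert_sound x U c P q1 q2 : valid_stream B x ->
  cert_ok (U, c, P, q1, q2) ->
  rVpoly q1 = inner_poly Fpt (Fmult x) (partner_query P) ->
  rVpoly q2 = inner_poly Fpt (Fmult x) (crossing_query U c) ->
  max_matching x = #|partner_pairs P|.
Proof.
move=> val_x /and4P[dis /forallP h1 /forallP h2 /eqP size_P] q1E q2E.
have bnd u v := mult_bounds u v val_x.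
apply: (max_matching_berge (U := U) (c := c)) => //.
  apply/andP; split => //; apply/forall_inP => -[u v]; rewrite inE => /andP[/= uv /eqP Pu].
  have := h1 u; rewrite Pu uv /= q1E (inner_poly_pts Fpt_inj).
  rewrite (bigD1 v) //= big1 ?addr0 => [|w wv]; last first.
    by rewrite /partner_query Pu eq_sym (negPf wv) mulr0.
  rewrite /partner_query Pu eqxx mulr1 /Fmult => nz.
  rewrite /edgeG uv /= lt_neqAle (proj1 (bnd u v)) andbT eq_sym.
  by apply: contraNneq nz => ->.
apply/separated_edges => u v /andP[uv mult_gt0] uU vU.
apply/eqP/negPn/negP => cuv.
pose S := \sum_w mult x u w * [&& u \notin U, w \notin U & c u != c w]%:R.
have term_ge0 w : 0 <= mult x u w * [&& u \notin U, w \notin U & c u != c w]%:R.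
  by rewrite mulr_ge0 ?ler0n // (proj1 (bnd u w)).
have S_le : S <= (n * B)%:Z.
  apply: le_trans (_ : \sum_(w < n) B%:Z <= _).
    apply: ler_sum => w _; have [ge0 leB] := bnd u w.
    by case: (_ && _); rewrite ?mulr1 ?mulr0.
  by rewrite sumr_const card_ord -mulr_natl natz PoszM.
have S_gt0 : 0 < S.
  rewrite /S (bigD1 v) //=; apply: ltr_wpDr; first exact: sumr_ge0.
  by rewrite uU vU cuv mulr1.
have := h2 u; rewrite q2E (inner_poly_pts Fpt_inj).
have -> : \sum_w Fmult x u w * crossing_query U c u w = S%:~R.
  rewrite /S rmorph_sum /=; apply: eq_bigr => w _.
  by rewrite rmorphM /= rmorph_nat.
rewrite int_Fp_eq0 ?(ltW S_gt0) ?gt_eqF //.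
by apply: le_lt_trans S_le _; rewrite ltz_nat.
Qed.

(** The certificate does not depend on [r]. If both polynomials are exact the answer is never wrong;
    otherwise a single false one already has to pass its query, so no union bound is taken. *)
Lemma verdict_sound x ct : valid_stream B x ->
  (3 * #|[set r | if verdict r (sketch r x) ct is Some k then k != max_matching x
                  else false]| <= p)%N.
Proof.
case: ct => [[[[U c] P] q1] q2] val_x; rewrite /verdict.
have [ok|_] := boolP (cert_ok _); last first.
  by rewrite (_ : [set _ | _] = set0) ?cards0 //; apply/setP => r; rewrite !inE.
have [q1E|/query_ok_sound q1N] := eqVneq (rVpoly q1) (inner_poly Fpt (Fmult x) (partner_query P)).
  have [q2E|/query_ok_sound q2N] := eqVneq (rVpoly q2) (inner_poly Fpt (Fmult x) (crossing_query U c)).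
    rewrite (_ : [set _ | _] = set0) ?cards0 //; apply/setP => r; rewrite !inE.
    by case: ifP => // _; rewrite (exact_cert_sound val_x ok q1E q2E) eqxx.
  apply: leq_trans q2N; rewrite leq_mul2l /=; apply/subset_leq_card/subsetP => r.
  by rewrite !inE /=; case: ifP => // /andP[].
apply: leq_trans q1N; rewrite leq_mul2l /=; apply/subset_leq_card/subsetP => r.
by rewrite !inE /=; case: ifP => // /andP[].
Qed.

(** The prover never sees [r], so one certificate must work for all [r]; completeness is then
    perfect. *)
Lemma verdict_complete x : valid_stream B x ->
  exists ct, forall r, verdict r (sketch r x) ct = Some (max_matching x).
Proof.
move=> val_x; have [U [c0 [P [mP sep PE]]]] := max_matching_witness x.
pose c := [ffun u => c0 u].
have cE : berge U c = berge U c0.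
  congr addn; apply: eq_bigr => k _; congr (_./2); apply: eq_card => u.
  by rewrite !inE ffunE.
pose q1 := poly_rV (d := (2 * n)%N) (inner_poly Fpt (Fmult x) (partner_query P)).
pose q2 := poly_rV (d := (2 * n)%N) (inner_poly Fpt (Fmult x) (crossing_query U c)).
exists (U, c, P, q1, q2) => r.
suff ok : cert_ok (U, c, P, q1, q2).
  by rewrite /verdict ok /cert_queries !query_ok_complete (max_matching_berge mP sep PE).
have bnd u v := mult_bounds u v val_x.
have [/forall_inP sP dis] := andP mP.
apply/and4P; split => //; last by rewrite cE PE.
  apply/forallP => u; apply/implyP => uP.
  rewrite poly_rV_K ?size_inner_poly // (inner_poly_pts Fpt_inj).
  rewrite (bigD1 (P u)) //= big1 ?addr0 => [|w wv]; last first.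
    by rewrite /partner_query eq_sym (negPf wv) mulr0.
  rewrite /partner_query eqxx mulr1 /Fmult.
  have /andP[_ mult_gt0] : edgeG x u (P u) by apply: (sP (u, P u)); rewrite inE uP /=.
  have [mult_ge0 mult_le] := bnd u (P u).
  rewrite int_Fp_eq0 ?gt_eqF //; apply: le_lt_trans mult_le _.
  by rewrite ltz_nat (leq_ltn_trans _ p_gt) // leq_pmull // (leq_trans _ (ltn_ord u)).
apply/forallP => u; rewrite poly_rV_K ?size_inner_poly // (inner_poly_pts Fpt_inj).
apply/eqP/big1 => v _; rewrite /crossing_query.
case: and3P => [[uU vU]|]; last by rewrite mulr0.
rewrite !ffunE => cuv; rewrite mulr1 /Fmult.
suff -> : mult x u v = 0 by [].
apply/eqP; rewrite eq_le (proj1 (bnd u v)) andbT leNgt; apply: contra cuv => mult_gt0.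
case: (ltnP u v) => uv.
  by apply/eqP; apply: (separated_edges _ _ _ sep); rewrite // /edgeG uv.
move: mult_gt0; rewrite /mult big_seq_cond big1 ?ltxx // => t /and3P[tx /eqP tu /eqP tv].
have /andP[/allP/(_ t tx)] := val_x.
by rewrite /valid_tok tu tv ltnNge uv.
Qed.

(** [U], [c] and [P] have at most p^n values each and the two coefficient vectors p^(2n) each, in
    all p^(7n). *)
Lemma card_cert b : (0 < n)%N -> (p <= 2 ^ b)%N -> (#|cert| <= 2 ^ (7 * n * b))%N.
Proof.
move=> n_gt0 pb.
have np : (n <= p)%N := leq_trans (leq_pmull n (isT : 0 < 6)%N) p_ge.
have -> : #|cert| = (2 ^ n * n ^ n * n ^ n * p ^ (2 * n) * p ^ (2 * n))%N.
  rewrite !card_prod -[#|{set _}|]cardsT -powersetT card_powerset cardsT !card_ffun !card_mx card_Fp //.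
  by rewrite !card_ord !mul1n.
apply: leq_trans (_ : p ^ n * p ^ n * p ^ n * p ^ (2 * n) * p ^ (2 * n) <= _)%N.
  by rewrite !leq_mul // leq_exp2r // prime_gt1.
rewrite -!expnD (_ : n + n + n + 2 * n + 2 * n = 7 * n)%N; last by clear; lia.
by rewrite [(7 * n * b)%N]mulnC (expnM 2) leq_exp2r // muln_gt0.
Qed.

End Checks.

(** * Bit codes and the register that receives them *)

Section ShiftRegister.
Variable L : nat.

Definition shift (t : L.-tuple bool) (b : bool) : L.-tuple bool :=
  [tuple of behead (rcons t b)].

Lemma foldl_shift t s : foldl shift t s = drop (size s) (t ++ s) :> seq bool.
Proof.
elim: s t => [|b s IHs] t /=; first by rewrite drop0 cats0.
by rewrite IHs -cat_rcons /= headI.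
Qed.

Lemma foldl_shift_full t s : size s = L -> foldl shift t s = s :> seq bool.
Proof. by move=> sL; rewrite foldl_shift drop_size_cat // size_tuple. Qed.

End ShiftRegister.

(** Elements are coded by their rank; [dec] is partial because a dishonest annotation may be no
    codeword. *)
Lemma finite_code (S D : finType) : #|S| <= #|D| ->
  exists (enc : S -> D) (dec : D -> option S), pcancel enc dec.
Proof.
move=> leSD; pose enc c := enum_val (widen_ord leSD (enum_rank c)) : D.
have enc_inj : injective enc.
  by move=> c d /enum_val_inj/(congr1 val)/= /val_inj/enum_rank_inj.
exists enc, (fun d => [pick c | enc c == d]) => c.
by case: pickP => [d /eqP/enc_inj -> //|/(_ c)]; rewrite eqxx.
Qed.

(** * The streaming verifier *)

Section Verifier.
Variables (p n L : nat) (dec : L.-tuple bool -> option (cert p n)).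
Local Open Scope ring_scope.

Definition mm_state : finType := ('F_p * {ffun 'I_n -> 'F_p} * L.-tuple bool)%type.

(** Interpolation is linear, so a token (u, v, Delta) changes only the sketch of column v, by Delta
    times the value at [r] of the basis polynomial of u. *)
Definition mm_tok (s : mm_state) (tk : token n) : mm_state :=
  let: (r, sigma, t) := s in
  (r, [ffun v => sigma v +
         if tk.1.2 == v then tk.2%:~R * (lagrange_basis (@Fpt p n) tk.1.1).[r] else 0], t).

(* Keeping only the last L annotation bits is harmless: soundness holds for any
   certificate, whatever the annotation it is read from. *)
Definition mm_bit (s : mm_state) (b : bool) : mm_state :=
  let: (r, sigma, t) := s in (r, sigma, shift t b).

Definition mm_out (s : mm_state) : option nat :=
  let: (r, sigma, t) := s in if dec t is Some ct then verdict r sigma ct else None.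

Definition mm_verifier : verifier n :=
  @Verifier n mm_state 'F_p (fun r => (r, [ffun=> 0], [tuple of nseq L false]))
    mm_tok mm_bit mm_out.

Lemma sketch_cons r tk x v : sketch r (tk :: x) v =
  (if tk.1.2 == v then tk.2%:~R * (lagrange_basis (@Fpt p n) tk.1.1).[r] else 0)
    + sketch r x v.
Proof.
rewrite !ffunE !horner_sum.
under eq_bigr do rewrite hornerZ /Fmult mult_cons rmorphD mulrDl /=.
rewrite big_split /=; congr (_ + _); last by apply: eq_bigr => u _; rewrite [RHS]hornerZ.
rewrite (bigD1 tk.1.1) //= eqxx /= big1 ?addr0 => [|u].
  by case: ifP => _; rewrite ?mul0r.
by rewrite eq_sym => /negPf ->; rewrite /= mul0r.
Qed.

Lemma mm_bits r sigma t s :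
  foldl mm_bit (r, sigma, t) s = (r, sigma, foldl (@shift L) t s).
Proof. by elim: s t => //= b s IHs t. Qed.

(** Tokens act only on [sigma] and annotation bits only on the register, so their interleaving is
    immaterial. *)
Lemma mm_run_state r sigma t x ann : size ann = size x ->
  foldl (fun s q => foldl mm_bit (mm_tok s q.1) q.2) (r, sigma, t) (zip x ann) =
  (r, [ffun v => sigma v + sketch r x v], foldl (@shift L) t (flatten ann)).
Proof.
elim: x ann sigma t => [|tk x IHx] [|a ann] //= sigma t.
  move=> _; congr (_, _, _); apply/ffunP => v; rewrite !ffunE horner_sum big1 ?addr0 //.
  by move=> u _; rewrite hornerZ /Fmult /mult big_nil mul0r.
case=> /IHx {}IHx; rewrite mm_bits IHx foldl_cat; congr (_, _, _).
by apply/ffunP => v; rewrite [LHS]ffunE [RHS]ffunE sketch_cons ffunE addrA.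
Qed.

Lemma mm_runE (r : V_rand mm_verifier) x ann : size ann = size x ->
  V_run r x ann =
  if dec (foldl (@shift L) [tuple of nseq L false] (flatten ann)) is Some ct
  then verdict r (sketch r x) ct else None.
Proof.
move=> sz; rewrite /V_run /= mm_run_state //=.
suff -> : [ffun v => [ffun=> 0] v + sketch r x v] = sketch r x by [].
by apply/ffunP => v; rewrite [LHS]ffunE [X in X + _]ffunE add0r.
Qed.

End Verifier.

(** * Assembling the online scheme and bounding its cost *)

Lemma flatten_honest_ann n (h : seq (token n) -> seq bool) x :
  (0 < size x)%N -> (forall y, (size y < size x)%N -> h y = [::]) ->
  flatten (honest_ann h x) = h x.
Proof.
case/lastP: x => // x tk _ h0; rewrite /honest_ann size_rcons -addn1 iotaD map_cat.
rewrite flatten_cat /= add0n cats0 take_oversize ?size_rcons //.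
have -> : [seq h (take i.+1 (rcons x tk)) | i <- iota 0 (size x)] =
          [seq [::] | i <- iota 0 (size x)].
  apply/eq_in_map => i; rewrite mem_iota add0n => /andP[_ ix]; apply: h0.
  by rewrite size_takel size_rcons ltnS // ltnW.
by elim: (iota _ _).
Qed.

Lemma mm_scheme n B m p b : prime p -> (6 * n <= p)%N -> (n * B < p)%N ->
  (p <= 2 ^ b)%N -> (0 < n)%N -> (0 < m)%N ->
  exists (V : verifier n) (h : seq (token n) -> seq bool),
    online_scheme_maxmatching B m V h /\
    forall x : seq (token n), size x = m ->
      (help_cost h x + space_cost V <= 16 * n * b)%N.
Proof.
move=> p_pr p_ge p_gt pb n_gt0 m_gt0.
pose L := (7 * n * b)%N.
have : (#|cert p n| <= #|{: L.-tuple bool}|)%N.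
  by rewrite card_tuple card_bool card_cert.
case/finite_code => enc [dec encK].
pose good x (ct : cert p n) := [forall r, verdict r (sketch r x) ct == Some (max_matching x)].
(* Silent until the stream has length [m], [h] then sends the code of a certificate accepted at
   every [r]; on valid streams one exists, so the inner default is not reached. *)
pose h x : seq bool :=
  if (size x == m) then (if [pick ct | good x ct] is Some ct then enc ct : seq bool else [::])
  else [::].
have hE x : size x = m -> flatten (honest_ann h x) = h x.
  move=> xm; apply: flatten_honest_ann; rewrite xm // => y ym.
  by rewrite /h (ltn_eqF ym).
exists (mm_verifier dec), h; split; last first.
  move=> x xm; rewrite /help_cost /space_cost -size_flatten hE //.
  have h_le : (size (h x) <= L)%N.
    by rewrite /h xm eqxx; case: pickP => [ct _|//]; rewrite size_tuple.
  have sp : (up_log 2 #|V_state (mm_verifier dec)| <= b + n * b + L)%N.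
    apply: up_log_min => //; rewrite !card_prod card_ffun card_tuple card_bool card_Fp //.
    rewrite card_ord !expnD !leq_mul // mulnC expnM.
    by rewrite leq_exp2r.
  (* Help is 7nb bits and memory b + nb + 7nb, where b <= nb. *)
  apply: leq_trans (leq_add h_le sp) _; rewrite /L; nia.
have card_r : #|V_rand (mm_verifier dec)| = p by rewrite /= card_Fp.
split; first by rewrite card_r prime_gt0.
have sz_h x : size x = m -> size (honest_ann h x) = size x.
  by move=> _; rewrite size_map size_iota.
split=> [x xm val_x|x xm val_x ann annm].
  rewrite (_ : [set _ | _] = set0) ?cards0 //; apply/setP => r; rewrite !inE.
  rewrite mm_runE ?sz_h // hE //.
  have : exists2 ct, good x ct & h x = enc ct.
    rewrite /h xm eqxx; case: pickP => [ct ct_ok|no]; first by exists ct.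
    have [ct ct_ok] := verdict_complete p_pr p_ge p_gt val_x.
    by have /forallP[] := negbT (no ct) => r'; rewrite ct_ok.
  case=> ct /forallP/(_ r)/eqP ct_ok ->.
  have -> : foldl (@shift L) [tuple of nseq L false] (enc ct) = enc ct.
    by apply: val_inj; rewrite /= foldl_shift_full ?size_tuple.
  by rewrite encK ct_ok eqxx.
rewrite card_r.
case E: (dec (foldl (@shift L) [tuple of nseq L false] (flatten ann))) => [ct|].
  apply: leq_trans (verdict_sound p_pr p_ge p_gt ct val_x).
  rewrite leq_mul2l; apply/orP; right; apply/subset_leq_card/subsetP => r.
  by rewrite !inE mm_runE ?annm ?xm // E.
rewrite (_ : [set _ | _] = set0) ?cards0 //; apply/setP => r; rewrite !inE.
by rewrite mm_runE ?annm ?xm // E.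
Qed.

(** This serves [B = 0], where the cost bound is zero, and [m = 0], where there is no token after
    which to send a certificate; in both cases the answer is 0. *)
Lemma trivial_scheme n B m :
  (forall x : seq (token n), size x = m -> valid_stream B x -> max_matching x = 0) ->
  exists (V : verifier n) (h : seq (token n) -> seq bool),
    online_scheme_maxmatching B m V h /\
    forall x : seq (token n), (help_cost h x + space_cost V = 0)%N.
Proof.
move=> mm0.
exists (@Verifier n unit unit id (fun s _ => s) (fun s _ => s) (fun=> Some 0)), (fun=> [::]).
split; last first.
  move=> x; rewrite /help_cost /space_cost card_unit up_log1 addn0 /honest_ann -map_comp.
  by elim: (iota _ _).
split; first by rewrite card_unit.
by split=> [x xm val_x|x xm val_x ann _];
   rewrite (_ : [set _ | _] = set0) ?cards0 //; apply/setP => r;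
   rewrite !inE /V_run /= mm0.
Qed.

Theorem theorem3p2 :
  forall k : nat, exists C : nat,
  forall n B m : nat, (2 <= n)%N -> (B <= n ^ k)%N ->
  exists (V : verifier n) (h : seq (token n) -> seq bool),
    online_scheme_maxmatching B m V h /\
    forall x : seq (token n), size x = m -> valid_stream B x ->
      (help_cost h x + space_cost V <= C * B * n * trunc_log 2 n)%N.
Proof.
(* The factor 16 comes from [mm_scheme], and 13(k+1) bounds the bit length of p in units of
   [trunc_log 2 n]. *)
move=> k; exists (16 * 13 * k.+1)%N => n B m n_ge2 Bk.
have [triv|] := boolP ((B == 0) || (m == 0))%N.
  have [|V [h [VP cost]]] := @trivial_scheme n B m; last first.
    by exists V, h; split => // x _ _; rewrite cost.
  move=> x xm val_x; apply: max_matching_trivial => u v.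
  case/orP: triv => /eqP E.
    have [ge0 leB] := mult_bounds u v val_x.
    by apply/eqP; rewrite eq_le ge0 andbT -[0%R]/(0%:Z)%R -E.
  by move: xm; rewrite E => /size0nil ->; rewrite /mult big_nil.
rewrite negb_or -!lt0n => /andP[B_gt0 m_gt0].
set l := trunc_log 2 n.
have l_gt0 : (0 < l)%N by rewrite trunc_log_gt0.
(* The logarithm is rounded down: n < 2^(l+1) <= 2^(2l), as l >= 1. *)
have n_le : (n <= 2 ^ (2 * l))%N.
  apply: leq_trans (ltnW (trunc_log_ltn n (isT : 1 < 2)%N)) _.
  by rewrite leq_exp2l //; lia.
have N_le : (6 * n ^ k.+1 <= 2 ^ (2 * l * k.+1 + 3))%N.
  by rewrite addnC expnD leq_mul // expnM leq_exp2r.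
(* A prime above 6 n^(k+1) exceeds both 6n, for soundness, and nB, against wraparound. *)
have [p p_pr /andP[ltp lep]] := prime_between N_le.
have n_le_N : (n <= n ^ k.+1)%N by rewrite -{1}(expn1 n) leq_exp2l.
have nB_le_N : (n * B <= n ^ k.+1)%N by rewrite expnS leq_mul2l Bk orbT.
have [||V [h [VP cost]]] := @mm_scheme n B m p _ p_pr _ _ lep (ltnW n_ge2) m_gt0.
- by lia.
- by lia.
exists V, h; split => // x xm _; apply: leq_trans (cost x xm) _.
(* The left side is 4l(k+1) + 9, and l(k+1) >= 1. *)
have bE : ((2 * l * k.+1 + 3).*2 + 3 <= 13 * k.+1 * l)%N by nia.
apply: leq_trans (leq_mul (leqnn (16 * n)) bE) _.
rewrite (_ : 16 * 13 * k.+1 * B * n * l = B * (16 * n * (13 * k.+1 * l)))%N; last by lia.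
exact: leq_pmull.
Qed.
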